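(* Let $(M,\omega)$ be a symplectic manifold with a system of regular, irreducible second class constraints $\Phi^\alpha$, $\alpha=1,\dots,d$ (not necessarily forming a closed algebra), and let $\Pi_D$ be the associated Dirac bivector, defined on a neighborhood $S\subset M$ of the constraint surface $C$. Then $\Pi_D$ and the symplectic form $\omega$ are compatible within the domain $S\subset M$ of definition of $\Pi_D$; that is, for every symplectic leaf $L$ of $(S,\Pi_D)$ with embedding $\iota_L\colon L\hookrightarrow S\subset M$, the symplectic form $\Omega_L$ induced by $\Pi_D$ on $L$ equals $\iota_L^*\omega$.
   Context: All manifolds and maps are smooth. For a symplectic manifold $(M,\omega)$ put $\omega^\sharp(v)=\omega(v,\cdot)$; the Poisson bivector $\Pi$ is given by $\Pi^\sharp=-(\omega^\sharp)^{-1}$, where $\Pi^\sharp(\alpha)=\Pi(\alpha,\cdot)$, and $\{f,g\}=\Pi(df,dg)$. The same sign convention $\Omega_L^\sharp=-(\Pi_L^\sharp)^{-1}$ relates the symplectic form $\Omega_L$ of a symplectic leaf $L$ to the nondegenerate bivector $\Pi_L$ induced on it. Constraints $\Phi^1,\dots,\Phi^d\in C^\infty(M)$ define the constraint surface $C=\bigcap_\alpha(\Phi^\alpha)^{-1}(0)$; regular and irreducible means $d\Phi^1\wedge\dots\wedge d\Phi^d$ vanishes nowhere on $C$. Set $F^{\alpha\beta}=\{\Phi^\alpha,\Phi^\beta\}$; the constraints are second class, i.e. $\det F^{\alpha\beta}\neq0$ at every point of $C$. $S$ is a (tubular) neighborhood of $C$ on which the matrix $F^{\alpha\beta}$ is invertible,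 with inverse $G_{\alpha\beta}$. The Dirac bivector on $S$ is $$\Pi_D=\Pi+\tfrac12G_{\alpha\beta}\,v^\alpha\wedge v^\beta,\qquad v^\alpha=\{\cdot,\Phi^\alpha\},$$ which is a Poisson bivector having the $\Phi^\alpha$ as Casimir functions. *)

(* Defs.v *)
From mathcomp Require Import all_boot all_order all_algebra.
From mathcomp Require Import all_classical all_reals all_analysis.

Set Implicit Arguments.
Unset Strict Implicit.
Unset Printing Implicit Defensive.

Import Order.TTheory GRing.Theory Num.Theory.
Import numFieldNormedType.Exports.

Local Open Scope classical_set_scope.
Local Open Scope ring_scope.

(** * Smooth maps between (open subsets of) R^n and normed spaces *)

Fixpoint Ck {R : realType} {n : nat} {W : normedModType R} (k : nat)
    (U : set 'rV[R]_n) (f : 'rV[R]_n -> W) : Prop :=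
  if k is k'.+1 then
    (forall x, U x -> differentiable f x) /\
    (forall v, Ck k' U (fun x => 'D_v f x))
  else forall x, U x -> {for x, continuous f}.

(** Only used on open [U]. *)
Definition smooth_on {R : realType} {n : nat} {W : normedModType R}
    (U : set 'rV[R]_n) (f : 'rV[R]_n -> W) : Prop :=
  forall k, Ck k U f.

(** * Smooth manifolds *)

Record chart (R : realType) (T : topologicalType) (n : nat) := Chart {
  cdom : set T ;
  cmap : T -> 'rV[R]_n ;
  cinv : 'rV[R]_n -> T ;
  cdom_open : open cdom ;
  cmap_open : open (cmap @` cdom) ;
  cmapK : forall p, cdom p -> cinv (cmap p) = p ;
  cmap_cont : {within cdom, continuous cmap} ;
  cinv_cont : {within cmap @` cdom, continuous cinv} }.

(** Coordinate expression of [f] from the chart [c] to the chart [c'], and the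
    open set of coordinates on which it is meaningful. *)
Definition in_charts {R : realType} {T T' : topologicalType} {m n : nat}
    (c : chart R T m) (c' : chart R T' n) (f : T -> T') : 'rV[R]_m -> 'rV[R]_n :=
  fun x => cmap c' (f (cinv c x)).

Definition in_charts_dom {R : realType} {T T' : topologicalType} {m n : nat}
    (c : chart R T m) (c' : chart R T' n) (f : T -> T') : set 'rV[R]_m :=
  cmap c @` (cdom c `&` f @^-1` cdom c').

(** The atlas need not be maximal.  [chart_at] selects, at each point, the chart
    of the atlas whose coordinates are used to write tangent vectors there. *)
Record manifold (R : realType) (n : nat) := Manifold {
  mspace :> topologicalType ;
  mspace_hausdorff : hausdorff_space mspace ;
  mspace_countable : @second_countable mspace ;
  atlas : set (chart R mspace n) ;
  atlas_compat : forall c c', atlas c -> atlas c' ->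
    smooth_on (in_charts_dom c c' id) (in_charts c c' id) ;
  chart_at : mspace -> chart R mspace n ;
  chart_at_atlas : forall p, atlas (chart_at p) ;
  chart_at_dom : forall p, cdom (chart_at p) p }.

Definition smooth_function {R : realType} {n : nat} (M : manifold R n)
    (f : M -> R) : Prop :=
  forall c, atlas c -> smooth_on (cmap c @` cdom c) (f \o cinv c : _ -> R^o).

Definition smooth_map {R : realType} {m n : nat} (N : manifold R m)
    (M : manifold R n) (f : N -> M) : Prop :=
  continuous f /\
  forall c c', atlas c -> atlas c' ->
    smooth_on (in_charts_dom c c' f) (in_charts c c' f).

(** * Tensors at a point *)

(** Tangent vectors and covectors at [p] are the rows of their components in
    [chart_at p].  Bilinear forms on either space are square matrices. *)
Definition tangent {R : realType} {n : nat} (M : manifold R n) (p : M) : Type :=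
  'rV[R]_n.

Definition cotangent {R : realType} {n : nat} (M : manifold R n) (p : M) : Type :=
  'rV[R]_n.

Definition pairing {R : realType} {n : nat} (a v : 'rV[R]_n) : R :=
  (a *m v^T) 0 0.

Definition form_eval {R : realType} {n : nat} (A : 'M[R]_n) (u v : 'rV[R]_n) : R :=
  (u *m A *m v^T) 0 0.

(** The musical map of a bilinear form: [sharp A u] is [A(u, .)]. *)
Definition sharp {R : realType} {n : nat} (A : 'M[R]_n) (u : 'rV[R]_n) : 'rV[R]_n :=
  u *m A.

(** The form [B] with [sharp B = - (sharp A)^-1]. *)
Definition neg_inverse {R : realType} {n : nat} (A : 'M[R]_n) : 'M[R]_n :=
  - invmx A.

(** [v /\ w = v (x) w - w (x) v], as a bilinear form on covectors. *)
Definition wedge2 {R : realType} {n : nat} (v w : 'rV[R]_n) : 'M[R]_n :=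
  v^T *m w - w^T *m v.

(** [a_1 /\ ... /\ a_d], as a multilinear form on tangent vectors. *)
Definition wedge {R : realType} {n d : nat} (a : 'I_d -> 'rV[R]_n)
    (v : 'I_d -> 'rV[R]_n) : R :=
  \det (\matrix_(i, j) pairing (a i) (v j)).

Definition dfun {R : realType} {n : nat} (M : manifold R n) (f : M -> R) (p : M) :
    cotangent p :=
  \row_i 'D_(delta_mx 0 i) (f \o cinv (chart_at p) : _ -> R^o)
            (cmap (chart_at p) p).

(** The tangent map at [p], acting on rows by [v |-> v *m dmap f p]; hence the
    pullback of a covector [a] is [a *m (dmap f p)^T]. *)
Definition dmap {R : realType} {m n : nat} (N : manifold R m) (M : manifold R n)
    (f : N -> M) (p : N) : 'M[R]_(m, n) :=
  'J (in_charts (chart_at p) (chart_at (f p)) f) (cmap (chart_at p) p).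

(** * Symplectic forms *)

Definition form_field {R : realType} {n : nat} (M : manifold R n) : Type :=
  M -> 'M[R]_n.

Definition pullback {R : realType} {m n : nat} (N : manifold R m)
    (M : manifold R n) (f : N -> M) (w : form_field M) : form_field N :=
  fun p => dmap f p *m w (f p) *m (dmap f p)^T.

(** Components of a covariant form in an arbitrary chart [c]: at coordinates [x],
    the form at [q = cinv c x] precomposed with the change of coordinates from
    [c] to [chart_at q]. *)
Definition form_in_chart {R : realType} {n : nat} (M : manifold R n)
    (w : form_field M) (c : chart R M n) : 'rV[R]_n -> 'M[R]_n :=
  fun x => let q := cinv c x in
    let J := 'J (in_charts c (chart_at q) id) x in
    J *m w q *m J^T.

Record symplectic_form {R : realType} {n : nat} (M : manifold R n)
    (w : form_field M) : Prop := SymplecticForm {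
  symplectic_smooth : forall c, atlas c ->
    smooth_on (cmap c @` cdom c) (form_in_chart w c) ;
  symplectic_skew : forall p, (w p)^T = - w p ;
  symplectic_closed : forall c, atlas c ->
    forall x, (cmap c @` cdom c) x -> forall i j k,
      let D := fun l => 'D_(delta_mx 0 l) (form_in_chart w c) x in
      D i j k + D j k i + D k i j = 0 ;
  symplectic_nondegenerate : forall p, bijective (sharp (w p)) }.

Definition bivector_field {R : realType} {n : nat} (M : manifold R n) : Type :=
  M -> 'M[R]_n.

Definition poisson_bivector {R : realType} {n : nat} (M : manifold R n)
    (w : form_field M) : bivector_field M :=
  fun p => neg_inverse (w p).

Definition bracket {R : realType} {n : nat} (M : manifold R n)
    (P : bivector_field M) (f g : M -> R) : M -> R :=
  fun p => form_eval (P p) (dfun f p) (dfun g p).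

(** The vector field [{., f}], i.e. [a(v) = P(a, df)] for every covector [a]. *)
Definition bracket_field {R : realType} {n : nat} (M : manifold R n)
    (P : bivector_field M) (f : M -> R) (p : M) : tangent p :=
  (P p *m (dfun f p)^T)^T.

(** * Second class constraints and the Dirac bivector *)

Definition constraint_surface {R : realType} {n d : nat} (M : manifold R n)
    (Phi : 'I_d -> M -> R) : set M :=
  [set p | forall a, Phi a p = 0].

Definition constraint_matrix {R : realType} {n d : nat} (M : manifold R n)
    (w : form_field M) (Phi : 'I_d -> M -> R) (p : M) : 'M[R]_d :=
  \matrix_(a, b) bracket (poisson_bivector w) (Phi a) (Phi b) p.

Definition regular_irreducible {R : realType} {n d : nat} (M : manifold R n)
    (Phi : 'I_d -> M -> R) : Prop :=
  forall p, constraint_surface Phi p ->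
    exists v : 'I_d -> tangent p, wedge (fun a => dfun (Phi a) p) v != 0.

Definition second_class {R : realType} {n d : nat} (M : manifold R n)
    (w : form_field M) (Phi : 'I_d -> M -> R) : Prop :=
  forall p, constraint_surface Phi p -> \det (constraint_matrix w Phi p) != 0.

(** An open neighbourhood of the constraint surface on which the Dirac bivector
    is defined. *)
Definition dirac_domain {R : realType} {n d : nat} (M : manifold R n)
    (w : form_field M) (Phi : 'I_d -> M -> R) (S : set M) : Prop :=
  [/\ open S, constraint_surface Phi `<=` S &
      forall p, S p -> constraint_matrix w Phi p \in unitmx].

Definition dirac_bivector {R : realType} {n d : nat} (M : manifold R n)
    (w : form_field M) (Phi : 'I_d -> M -> R) : bivector_field M :=
  fun p =>
    let G := invmx (constraint_matrix w Phi p) in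
    let v := fun a => bracket_field (poisson_bivector w) (Phi a) p in
    poisson_bivector w p
    + 2^-1 *: \sum_a \sum_b G a b *: wedge2 (v a) (v b).

(** * Symplectic leaves *)

(** A nonempty connected immersed submanifold of [S] whose tangent spaces are the
    images of [sharp P]; the topology of [L] may be finer than the one induced
    from [M]. *)
Record integral_manifold {R : realType} {n k : nat} (M : manifold R n) (S : set M)
    (P : bivector_field M) (L : manifold R k) (iota : L -> M) : Prop :=
  IntegralManifold {
    intman_nonempty : [set: L] !=set0 ;
    intman_connected : connected [set: L] ;
    intman_sub : range iota `<=` S ;
    intman_smooth : smooth_map iota ;
    intman_injective : injective iota ;
    intman_immersion : forall x,
      injective (fun v : tangent x => v *m dmap iota x) ;
    intman_tangent : forall x,
      range (fun v : tangent x => v *m dmap iota x) = range (sharp (P (iota x))) }.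

Definition symplectic_leaf {R : realType} {n k : nat} (M : manifold R n) (S : set M)
    (P : bivector_field M) (L : manifold R k) (iota : L -> M) : Prop :=
  integral_manifold S P iota /\
  forall k' (L' : manifold R k') (iota' : L' -> M),
    integral_manifold S P iota' -> range iota `<=` range iota' ->
    range iota' `<=` range iota.

(** The bivector [Q] on [L] with [P(a, b) = Q(iota^* a, iota^* b)] for all
    covectors [a, b] on [M]; it is unique when [iota] is an immersion. *)
Definition leaf_bivector {R : realType} {n k : nat} (M : manifold R n)
    (P : bivector_field M) (L : manifold R k) (iota : L -> M) : bivector_field L :=
  fun x => xget 0 [set Q : 'M[R]_k | forall a b : cotangent (iota x),
    form_eval (P (iota x)) a b =
    form_eval Q (a *m (dmap iota x)^T) (b *m (dmap iota x)^T)].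

Definition leaf_form {R : realType} {n k : nat} (M : manifold R n)
    (P : bivector_field M) (L : manifold R k) (iota : L -> M) : form_field L :=
  fun x => neg_inverse (leaf_bivector P iota x).

Definition compatible {R : realType} {n : nat} (M : manifold R n) (S : set M)
    (P : bivector_field M) (w : form_field M) : Prop :=
  forall k (L : manifold R k) (iota : L -> M), symplectic_leaf S P iota ->
    forall x, leaf_form P iota x = pullback iota w x.

(* Main.v *)
(** The statement is pointwise linear algebra.  Let [W] be the matrix of the
    symplectic form, [P = - W^-1], [A] the matrix whose rows are the differentials
    of the constraints, so that [F = A P A^T], and [D] the Dirac bivector.  Then
    [D = P - P A^T F^-1 A P], whence [A D = 0] and [D W D = - D].  If [J] is the
    differential of the embedding of a leaf, then [D = J^T Q J] for the induced
    bivector [Q], which is invertible because [J] and [D] have the same row space.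
    Cancelling [J^T] and [J] in [D W D = - D] leaves [Q (J W J^T) Q = - Q], that is
    [J W J^T = - Q^-1]. *)

Require Import Defs.
From mathcomp Require Import all_boot all_order all_algebra.
From mathcomp Require Import all_classical all_reals all_analysis.

Set Implicit Arguments.
Unset Strict Implicit.

Import GRing.Theory Num.Theory.

Local Open Scope ring_scope.

Lemma eq_form_mx (R : pzRingType) (n : nat) (A B : 'M[R]_n) :
  (forall u v : 'rV_n, (u *m A *m v^T) 0 0 = (u *m B *m v^T) 0 0) -> A = B.
Proof.
move=> AB; apply/matrixP => i j.
have entry (C : 'M[R]_n) :
    ((delta_mx 0 i : 'rV_n) *m C *m (delta_mx 0 j : 'rV_n)^T) 0 0 = C i j.
  by rewrite -rowE trmx_delta -colE !mxE.
by have := AB (delta_mx 0 i) (delta_mx 0 j); rewrite !entry.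
Qed.

Lemma trmx_inv_skew (R : comUnitRingType) (n : nat) (A : 'M[R]_n) :
  A^T = - A -> (invmx A)^T = - invmx A.
Proof.
(* A singular [A] is its own [invmx], so in that case the claim is the hypothesis. *)
move=> skA; have [uA | nuA] := boolP (A \in unitmx); last by rewrite invmx_out.
by rewrite trmx_inv skA -scaleN1r invmxZ ?invrN1 ?scaleN1r // -skA unitmx_tr.
Qed.

(** Turns the tangency condition of a leaf, an equality of sets of vectors, into an equality of row
    spaces. *)
Lemma eq_range_eqmx (F : fieldType) (m p n : nat) (A : 'M[F]_(m, n))
    (B : 'M[F]_(p, n)) :
  range (fun v : 'rV_m => v *m A) = range (fun v : 'rV_p => v *m B) ->
  (A == B)%MS.
Proof.
move=> AB; apply/andP; split; apply/row_subP => i.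
  have : range (fun v : 'rV_p => v *m B) (row i A).
    by rewrite -AB; exists (delta_mx 0 i); rewrite ?rowE.
  by case=> v _ <-; exact: submxMl.
have : range (fun v : 'rV_m => v *m A) (row i B).
  by rewrite AB; exists (delta_mx 0 i); rewrite ?rowE.
by case=> v _ <-; exact: submxMl.
Qed.

Section SkewFactorization.
Variables (F : fieldType) (k n : nat) (J : 'M[F]_(k, n)) (D : 'M[F]_n).
Hypotheses (freeJ : row_free J) (eqJD : (J == D)%MS).

(** For a right inverse [K] of [J], multiplication by [K *m J] on the right fixes the row space of
    [J], hence fixes [D]. Skewness transfers this to the left side, so [K^T *m D *m K] serves as
    [Q]. *)
Lemma skew_factor : D^T = - D -> exists Q : 'M[F]_k, D = J^T *m Q *m J.
Proof.
move=> skD; have [K JK] := row_freeP freeJ.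
have /submxP[Y DY] : (D <= J)%MS by case/andP: eqJD.
have DKJ : D *m K *m J = D by rewrite DY -(mulmxA Y) JK mulmx1.
have JKD : J^T *m (K^T *m D) = D.
  by apply: oppr_inj; rewrite -[in RHS]skD -[in RHS]DKJ !trmx_mul skD !mulmxN.
by exists (K^T *m D *m K); rewrite mulmxA JKD.
Qed.

Lemma factor_neg_inverse (Q : 'M[F]_k) (W : 'M[F]_n) :
  D = J^T *m Q *m J -> D *m W *m D = - D ->
  - invmx Q = J *m W *m J^T.
Proof.
move=> DQ DWD; have [K JK] := row_freeP freeJ.
have KJ : K^T *m J^T = 1%:M by rewrite -trmx_mul JK trmx1.
(* The reverse inclusion of row spaces makes [Q] invertible: with [J = Y *m D], the matrix
   [Y *m J^T] is a left inverse of [Q]. *)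
have /submxP[Y JY] : (J <= D)%MS by case/andP: eqJD.
have YQ : Y *m J^T *m Q = 1%:M.
  by rewrite -[RHS]JK [in RHS]JY DQ !mulmxA -(mulmxA _ J K) JK mulmx1.
have uQ : Q \in unitmx by case/mulmx1_unit: YQ.
have QWQ : Q *m (J *m W *m J^T) *m Q = - Q.
  have : K^T *m (D *m W *m D) *m K = K^T *m (- D) *m K by rewrite DWD.
  rewrite DQ mulmxN mulNmx !mulmxA KJ mul1mx.
  by rewrite -!(mulmxA _ J K) JK !mulmx1.
rewrite -[RHS](mulKmx uQ) -[X in _ *m X](mulmxK uQ) QWQ.
by rewrite mulNmx mulmxV // mulmxN mulmx1.
Qed.

End SkewFactorization.

Section DiracAlgebra.
Variables (F : fieldType) (n d : nat) (W : 'M[F]_n) (A : 'M[F]_(d, n)).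
Let P := - invmx W.
Let C := A *m P *m A^T.
Let D := P - P *m A^T *m invmx C *m A *m P.

Lemma dirac_mx_skew : W^T = - W -> D^T = - D.
Proof.
move=> skW; have skP : P^T = - P by rewrite linearN /= trmx_inv_skew.
have skC : C^T = - C.
  by rewrite /C !trmx_mul trmxK skP mulNmx mulmxN mulmxA.
rewrite /D linearB /= !trmx_mul trmxK skP trmx_inv_skew //.
by rewrite !(mulNmx, mulmxN) !opprK opprB !mulmxA addrC /P opprK.
Qed.

Lemma dirac_mx_reflexive : W \in unitmx -> C \in unitmx -> D *m W *m D = - D.
Proof.
move=> uW uC.
have AD : A *m D = 0 by rewrite mulmxBr !mulmxA mulmxV // mul1mx subrr.
(* Since [P *m W = -1], the sum of [D *m W] and the identity has [A] as its last factor, which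
   [A *m D = 0] then kills. *)
have DW : D *m W = P *m A^T *m invmx C *m A - 1%:M.
  by rewrite mulmxBl -(mulmxA _ P W) mulNmx mulVmx // mulmxN mulmx1 opprK addrC.
by rewrite DW mulmxBl mul1mx -mulmxA AD mulmx0 sub0r.
Qed.

End DiracAlgebra.

Section DiracBivector.
Variables (R : realType) (n d : nat) (M : manifold R n).
Variables (omega : form_field M) (Phi : 'I_d -> M -> R).

Let A (p : M) : 'M[R]_(d, n) := \matrix_a dfun (Phi a) p.

Lemma constraint_matrixE (p : M) :
  constraint_matrix omega Phi p = A p *m - invmx (omega p) *m (A p)^T.
Proof.
apply/matrixP => a b; rewrite mxE /bracket /form_eval /poisson_bivector /neg_inverse.
have -> : dfun (Phi a) p = row a (A p) by rewrite rowK.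
have -> : dfun (Phi b) p = row b (A p) by rewrite rowK.
by rewrite -row_mul !mxE; apply: eq_bigr => i _; rewrite !mxE.
Qed.

Lemma dirac_bivectorE (p : M) : (omega p)^T = - omega p ->
  let P := - invmx (omega p) in
  dirac_bivector omega Phi p =
  P - P *m (A p)^T *m invmx (A p *m P *m (A p)^T) *m A p *m P.
Proof.
move=> skW P; rewrite /dirac_bivector -/P constraint_matrixE -/P.
have skP : P^T = - P by rewrite linearN /= trmx_inv_skew.
set G := invmx _.
have skG : G^T = - G.
  apply: trmx_inv_skew.
  by rewrite !trmx_mul trmxK skP mulNmx mulmxN mulmxA.
(* The rows of [V] are the fields [{., Phi a}]; the sign comes from transposing the skew matrix
   [P]. *)
pose V : 'M[R]_(d, n) := - (A p *m P).
have VE a : bracket_field (poisson_bivector omega) (Phi a) p = row a V.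
  rewrite /bracket_field trmx_mul trmxK /poisson_bivector /neg_inverse -/P skP.
  by rewrite /V -mulmxN row_mul rowK.
have sumE (H : 'M[R]_d) : \sum_a \sum_b H a b *: ((row a V)^T *m row b V)
    = V^T *m H *m V.
  apply/matrixP => i j; rewrite mxE summxE.
  under eq_bigr do rewrite summxE.
  rewrite exchange_big; apply: eq_bigr => b _; rewrite mxE mulr_suml.
  by apply: eq_bigr => a _; rewrite !mxE big_ord1 !mxE mulrCA mulrA.
have -> : \sum_a \sum_b G a b *:
    wedge2 (bracket_field (poisson_bivector omega) (Phi a) p)
           (bracket_field (poisson_bivector omega) (Phi b) p)
    = V^T *m G *m V - V^T *m G^T *m V.
  rewrite -!sumE [X in _ - X]exchange_big -sumrB.
  apply: eq_bigr => a _; rewrite -sumrB; apply: eq_bigr => b _.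
  by rewrite !VE /wedge2 scalerBr !mxE.
(* As [G] is skew, both halves of the wedge product contribute [V^T *m G *m V], and the factor one
   half cancels. *)
rewrite skG (mulmxN V^T G) (mulNmx _ V) opprK -mulr2n.
rewrite -[X in _ *: X]scaler_nat scalerA mulVf ?pnatr_eq0 // scale1r; congr (_ + _).
have -> : V^T = P *m (A p)^T by rewrite linearN /= trmx_mul skP mulNmx opprK.
by rewrite /V mulmxN !mulmxA.
Qed.

End DiracBivector.

Unset Implicit Arguments.

Theorem proposition7 (R : realType) (n d : nat) (M : manifold R n)
    (omega : form_field M) (Phi : 'I_d -> M -> R) (S : set M)
    (omega_symplectic : symplectic_form omega)
    (Phi_smooth : forall a, smooth_function (Phi a))
    (Phi_regular : regular_irreducible Phi)
    (Phi_second_class : second_class omega Phi)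
    (S_domain : dirac_domain omega Phi S) :
  compatible S (dirac_bivector omega Phi) omega.
Proof.
move=> k L iota [[_ _ LS _ _ immersion tangentE] _] x.
have skW := symplectic_skew omega_symplectic (iota x).
have uW : omega (iota x) \in unitmx.
  (* Injectivity of [sharp] says that [omega] has trivial kernel at this point, which makes the
     square matrix invertible. *)
  rewrite -row_free_unit; apply: inj_row_free => v vW.
  apply: (bij_inj (symplectic_nondegenerate omega_symplectic (iota x))).
  by rewrite /sharp vW mul0mx.
have [_ _ /(_ (iota x) (LS _ (imageT _ _)))] := S_domain.
rewrite constraint_matrixE => uF.
rewrite /leaf_form /pullback /neg_inverse.
have DE := dirac_bivectorE Phi skW.
have skD := dirac_mx_skew (\matrix_a dfun (Phi a) (iota x)) skW.
have DWD := dirac_mx_reflexive uW uF.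
rewrite -DE in skD DWD.
have eqJD := eq_range_eqmx (tangentE x).
have freeJ : row_free (dmap iota x).
  apply: inj_row_free => v vJ; apply: immersion.
  exact: etrans vJ (esym (mul0mx _ _)).
have [Q0 DQ0] := skew_factor freeJ eqJD skD.
apply: (factor_neg_inverse freeJ eqJD) DWD.
(* The induced bivector is a chosen one, with default [0]. The factor [Q0] shows that a valid choice
   exists, which rules out the default; any valid choice factors the Dirac bivector through the
   embedding. *)
rewrite /leaf_bivector; case: xgetP => [Q _ DQ | /(_ Q0) []].
  apply: eq_form_mx => a b.
  by have := DQ a b; rewrite /form_eval trmx_mul trmxK !mulmxA.
by move=> a b; rewrite /form_eval DQ0 trmx_mul trmxK !mulmxA.
Qed.
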